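(* Let $f:\mathbb{R}^d\to\mathbb{R}$ be a convex function. The following conditions are equivalent: (1) $f$ cannot be uniformly approximated by strictly convex functions. (2) $f$ cannot be uniformly approximated by strongly convex functions. (3) There exist $k<d$, a linear projection $P:\mathbb{R}^d\to\mathbb{R}^k$, a convex function $c:\mathbb{R}^k\to\mathbb{R}$ and a linear function $\ell:\mathbb{R}^d\to\mathbb{R}$ such that $f=c\circ P+\ell$.
   Context: $f$ can be uniformly approximated by functions of a class if for every $\varepsilon>0$ there is a function $g:\mathbb{R}^d\to\mathbb{R}$ in the class with $|f-g|\leq\varepsilon$ on all of $\mathbb{R}^d$. $g$ is strictly convex if $g((1-t)x+ty)<(1-t)g(x)+tg(y)$ for all $x\neq y$ and $0<t<1$. A $C^2$ function $\varphi$ on an open set is strongly convex if its second derivative along every nonconstant straight line is strictly positive at every point. A not necessarily smooth function $g$ is strongly convex if every point $p$ has an open neighbourhood $V$ for which there is a strongly convex $\varphi\in C^2(V)$ such that $g-\varphi$ is convex on $V$. A linear projection $P:\mathbb{R}^d\to\mathbb{R}^k$ is a surjective linear map; $k$ is a nonnegative integer, and $\mathbb{R}^0=\{0\}$. *)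

(* Defs.v *)
From HB Require Import structures.
From mathcomp Require Import all_boot all_order all_algebra.
From mathcomp Require Import all_classical all_reals all_analysis.

Set Implicit Arguments.
Unset Strict Implicit.
Unset Printing Implicit Defensive.

Import Order.TTheory GRing.Theory Num.Theory.
Import numFieldNormedType.Exports.

Local Open Scope classical_set_scope.
Local Open Scope ring_scope.

Definition uniformly_approximable (R : realType) (d : nat)
    (class : set ('rV[R]_d -> R)) (f : 'rV[R]_d -> R) : Prop :=
  forall e : R, 0 < e -> exists2 g, class g & forall x, `|f x - g x| <= e.

Definition strictly_convex (R : realType) (d : nat) (g : 'rV[R]_d -> R) : Prop :=
  forall (x y : 'rV[R]_d) (t : R), x != y -> 0 < t < 1 ->
    g ((1 - t) *: x + t *: y) < (1 - t) * g x + t * g y.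

(** Functions on an open set [V] are represented by total functions; the
    notions below depend only on their values on [V]. *)

(** [V] is not assumed to be convex, so the inequality is required exactly on
    the segments contained in [V]. If [V] is convex, this amounts to
    [convex_function V h]. *)
Definition convex_on (R : realType) (d : nat) (V : set 'rV[R]_d)
    (h : 'rV[R]_d -> R) : Prop :=
  forall x y : 'rV[R]_d,
    (forall t : R, 0 <= t <= 1 -> V ((1 - t) *: x + t *: y)) ->
    forall t : R, 0 <= t <= 1 ->
      h ((1 - t) *: x + t *: y) <= (1 - t) * h x + t * h y.

(** All iterated partial derivatives of order at most [k] exist and are
    continuous on [V], for [V] open. *)
Fixpoint class_C (R : realType) (d : nat) (k : nat) (V : set 'rV[R]_d)
    (phi : 'rV[R]_d -> R) : Prop :=
  (forall x, V x -> {for x, continuous phi}) /\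
  if k is k'.+1 then
    forall i : 'I_d,
      (forall x, V x -> derivable phi x (delta_mx 0 i)) /\
      class_C k' V (fun x => 'D_(delta_mx 0 i) phi x)
  else True.

Definition strongly_convex_C2 (R : realType) (d : nat) (V : set 'rV[R]_d)
    (phi : 'rV[R]_d -> R) : Prop :=
  class_C 2 V phi /\
  forall (a v : 'rV[R]_d) (t : R), v != 0 -> V (a + t *: v) ->
    0 < derive1n 2 (fun s : R => phi (a + s *: v)) t.

Definition strongly_convex (R : realType) (d : nat) (g : 'rV[R]_d -> R) : Prop :=
  forall p : 'rV[R]_d, exists V : set 'rV[R]_d,
    [/\ open V, V p &
        exists2 phi : 'rV[R]_d -> R,
          strongly_convex_C2 V phi & convex_on V (fun x => g x - phi x)].

(* Main.v *)
Require Import Defs.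
From mathcomp Require Import all_boot all_order all_algebra.
From mathcomp Require Import all_classical all_reals all_analysis.
From HB Require Import structures.
From mathcomp Require Import ring lra.
Set Implicit Arguments.
Unset Strict Implicit.
Unset Printing Implicit Defensive.

Import Order.TTheory GRing.Theory Num.Theory.
Import numFieldNormedType.Exports.
Local Open Scope classical_set_scope.
Local Open Scope ring_scope.

(** The hinge between the three conditions is a fourth one: [f] is affine in
    some direction, that is, there are [v != 0] and [a] with
    [f (x + t *: v) = f x + t * a] for all [x] and [t].

    It is a coordinate-free form of the factorization [f x = c (P x) + l x]
    through a space of smaller dimension: any nonzero [v] in the kernel of [P]
    will do ([factors_affine_in_direction]), and conversely [f] minus a linear form [l]
    with [l v = a] is constant along [v], so that it factors through a
    projection with kernel the line of [v] ([affine_in_direction_factors]).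

    If [f] is affine in the direction [v] and [g] stays at bounded distance
    from [f], then [s |-> g (s *: v) - s * a] is bounded on the whole real line;
    a bounded convex function on the line is constant, so [g] is not strictly
    convex ([affine_in_direction_not_approximable]). A fortiori [g] is not
    strongly convex, since strong convexity implies strict convexity
    ([strongly_convex_strictly]).

    Suppose now that [f] is affine in no direction. A convex function has an
    affine minorant touching it at any given point ([subgradient_exists]). If
    the slopes of all affine minorants had the same value [a] on some [v != 0],
    these touching minorants would give [f (x + t *: v) >= f x + t * a] for all
    [x] and [t], hence equality after exchanging the two points
    ([affine_along]). So the slopes span affinely the dual space, and there are
    finitely many affine minorants [l_0, ..., l_n] of [f] whose slopes already
    do ([spanning_slopes]). With [H_i = f - l_i + 1 >= 1], the function

      [g = f + e / (n + 1) * (1 / H_0 + ... + 1 / H_n)]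

    satisfies [f <= g <= f + e], and for [e <= 1] it is strongly convex
    ([smoothing_strongly_convex]). Indeed, up to an affine function, [g] is the
    mean of the [H_i + e / H_i]. Call the convexity defect of [h] the quantity
    [(1 - t) * h x + t * h y - h ((1 - t) *: x + t *: y)]. Since
    [s |-> s + e / s] is increasing and strictly convex on [[1, +oo[], the
    defect of [H_i + e / H_i] is at least a multiple of
    [t * (1 - t) * (H_i x - H_i y) ^+ 2] where the [H_i] are bounded
    ([reciprocal_defect]). For a fixed [i] this may vanish, but as [i] varies
    the differences [H_i x - H_i y] differ from each other by the values at
    [x - y] of the differences of the slopes, which are not all zero if
    [x != y]. Summing over [i] bounds the defect of [g] from below by that of a
    positive definite quadratic form. Strong convexity of [g] asks exactly that
    such a form can be subtracted from [g] locally, and so [g] may be as rough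
    as [f]. *)

Lemma convex_functionP (R : realType) (E : lmodType R) (f : E -> R) :
  @convex_function R E setT f <->
  forall x y t, 0 <= t <= 1 ->
    f ((1 - t) *: x + t *: y) <= (1 - t) * f x + t * f y.
Proof.
split=> [fc x y t /andP[t0 t1]|fc t x y _ _].
  have s01 : 0 <= 1 - t <= 1 by apply/andP; split; lra.
  have := fc (Itv01 (andP s01).1 (andP s01).2) x y (in_setT _) (in_setT _).
  by rewrite convRE /conv /= /unstable.onem subKr.
have := fc y x t%:num; rewrite convRE /conv /= /unstable.onem ge0 le1.
by rewrite [(1 - _) * _ + _]addrC [(1 - _) *: _ + _]addrC; exact.
Qed.

Section convex_functions.

Context {R : realType}.

(** * Affine minorants of convex functions *)

(** The one-dimensional step of the Hahn-Banach theorem: [lam], dominated by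
    [f] on [W], is extended by the value [a] at [e]. The bounds to be met by [a]
    are compatible because [f] is convex and [lam] respects convex
    combinations. *)
Lemma dominated_extension (E : lmodType R) (f lam : E -> R) (W : set E)
    (e : E) :
  @convex_function R E setT f -> W !=set0 ->
  (forall x y t, W x -> W y -> 0 <= t <= 1 -> W ((1 - t) *: x + t *: y) /\
    lam ((1 - t) *: x + t *: y) = (1 - t) * lam x + t * lam y) ->
  (forall x, W x -> lam x <= f x) ->
  exists a, forall x s, W x -> lam x + s * a <= f (x + s *: e).
Proof.
move=> /convex_functionP fc [w0 W0] Wc lamf.
(* Left difference quotients along [e] lie below right ones, so that [a] can be
   any number that separates them. *)
have key x y r s : W x -> W y -> 0 < r -> 0 < s ->
    (lam x - f (x - r *: e)) / r <= (f (y + s *: e) - lam y) / s.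
  move=> Wx Wy r0 s0.
  have rs0 : 0 < s + r by lra.
  pose t := r / (s + r).
  have t01 : 0 <= t <= 1.
    by apply/andP; split; rewrite /t ?ler_pdivrMr// ?ler_pdivlMr//; lra.
  have [Wz lamz] := Wc x y t Wx Wy t01.
  have := lamf _ Wz; rewrite lamz.
  have -> : (1 - t) *: x + t *: y
          = (1 - t) *: (x - r *: e) + t *: (y + s *: e).
    rewrite !scalerDr scalerN !scalerA addrACA -[LHS]addr0; congr (_ + _).
    suff -> : (1 - t) * r = t * s by rewrite addNr.
    by rewrite /t; field; rewrite gt_eqF.
  move=> /le_trans/(_ (fc _ _ _ t01)).
  have tE A B : (s + r) * ((1 - t) * A + t * B) = s * A + r * B.
    by rewrite /t; field; rewrite gt_eqF.
  rewrite -[X in is_true X -> _](ler_pM2l rs0) !tE.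
  move=> h; rewrite ler_pdivrMr// mulrAC ler_pdivlMr//; lra.
pose A := [set (lam xr.1 - f (xr.1 - xr.2 *: e)) / xr.2 | xr in
            [set xr : E * R | W xr.1 /\ 0 < xr.2]].
have A0 : A !=set0.
  by exists ((lam w0 - f (w0 - 1 *: e)) / 1), (w0, 1) => //=; split.
have Aub y s : W y -> 0 < s -> ubound A ((f (y + s *: e) - lam y) / s).
  by move=> Wy s0 _ [[x r] [Wx r0] <-] /=; exact: key.
have supA : has_sup A.
  by split => //; exists ((f (w0 + 1 *: e) - lam w0) / 1); exact: Aub.
exists (sup A) => x s Wx.
have [s0|s0|->] := ltgtP s 0; last by rewrite mul0r scale0r !addr0; exact: lamf.
- have s0' : 0 < - s by lra.
  have := ub_le_sup supA.2 (ex_intro2 _ _ (x, - s) (conj Wx s0') erefl).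
  by rewrite /= scaleNr opprK ler_pdivrMr//; lra.
- have := ge_sup A0 (Aub x s Wx s0).
  by rewrite ler_pdivlMr//; lra.
Qed.

(** The zero form on the zero space is dominated by [f] recentered at [x]; it
    is extended by one basis vector at a time. *)
Lemma subgradient_exists (d : nat) (f : 'rV[R]_d -> R) (x : 'rV[R]_d) :
  @convex_function R 'rV[R]_d setT f ->
  exists xi : 'cV[R]_d, forall u, f x + (u *m xi) 0 0 <= f (x + u).
Proof.
move=> /convex_functionP fc; pose h u := f (x + u) - f x.
have hc (u w : 'rV[R]_d) t : 0 <= t <= 1 ->
    h ((1 - t) *: u + t *: w) <= (1 - t) * h u + t * h w.
  move=> t01; rewrite /h; have := fc (x + u) (x + w) t t01.
  rewrite !scalerDr addrACA -scalerDl subrK scale1r; lra.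
have [xi Hxi] : exists xi : 'cV[R]_d, forall u : 'rV[R]_d,
    (forall i : 'I_d, (d <= i)%N -> u 0 i = 0) ->
    (u *m xi) 0 0 <= h u; last first.
  exists xi => u; have u0 (i : 'I_d) : (d <= i)%N -> u 0 i = 0.
    by rewrite leqNgt ltn_ord.
  by have := Hxi u u0; rewrite /h; lra.
(* [xi] is correct on the span of the first [j] basis vectors; the next step
   changes its coordinate [j] only. *)
suff: forall j, (j <= d)%N -> exists xi : 'cV[R]_d, forall u : 'rV[R]_d,
    (forall i : 'I_d, (j <= i)%N -> u 0 i = 0) -> (u *m xi) 0 0 <= h u.
  exact.
elim=> [_|j IH jd].
  exists 0 => u u0; rewrite mulmx0 mxE.
  have -> : u = 0 by apply/rowP => i; rewrite u0// mxE.
  by rewrite /h addr0 subrr.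
have [xi Hxi] := IH (ltnW jd).
pose jj := Ordinal jd; pose e : 'rV[R]_d := delta_mx 0 jj.
pose W := [set u : 'rV[R]_d | forall i : 'I_d, (j <= i)%N -> u 0 i = 0].
have [||u w t Wu Ww t01|//|a Ha] :=
  @dominated_extension _ h (fun u => (u *m xi) 0 0) W e.
- exact/convex_functionP.
- by exists 0 => i _; rewrite mxE.
- split=> [i ji|]; first by rewrite !mxE Wu// Ww// !mulr0 addr0.
  by rewrite mulmxDl -!scalemxAl !mxE.
exists (xi + (a - xi jj 0) *: delta_mx jj 0) => u Hu.
pose u' := u - u 0 jj *: e.
have Wu' : W u'.
  move=> i ji; rewrite !mxE eqxx /=; have [->|ij] := eqVneq i jj.
    by rewrite mulr1 subrr.
  rewrite mulr0 subr0 Hu// ltn_neqAle ji andbT.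
  by apply: contra ij => /eqP ij; apply/eqP/val_inj.
have := Ha u' (u 0 jj) Wu'; rewrite subrK.
have -> : (u' *m xi) 0 0 = (u *m xi) 0 0 - u 0 jj * xi jj 0.
  by rewrite mulmxBl -scalemxAl -rowE !mxE.
have -> : (u *m (xi + (a - xi jj 0) *: delta_mx jj 0)) 0 0
        = (u *m xi) 0 0 + (a - xi jj 0) * u 0 jj.
  by rewrite mulmxDr -scalemxAr -colE !mxE.
lra.
Qed.

Definition minorant_slope (d : nat) (f : 'rV[R]_d -> R) (xi : 'cV[R]_d) :=
  exists b, forall x, (x *m xi) 0 0 + b <= f x.

(** The inequality [f x + t * a <= f (x + t *: v)] holds for both signs of [t]
    and at every point; used backwards from [x + t *: v] it becomes the opposite
    inequality. *)
Lemma affine_along (d : nat) (f : 'rV[R]_d -> R) (v : 'rV[R]_d) (a : R) :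
  @convex_function R 'rV[R]_d setT f ->
  (forall xi, minorant_slope f xi -> (v *m xi) 0 0 = a) ->
  forall x t, f (x + t *: v) = f x + t * a.
Proof.
move=> fc va.
have le x t : f x + t * a <= f (x + t *: v).
  have [xi Hxi] := subgradient_exists x fc.
  rewrite -(va xi); first by have := Hxi (t *: v); rewrite -scalemxAl !mxE.
  exists (f x - (x *m xi) 0 0) => y; have := Hxi (y - x).
  by rewrite [x + _]addrC subrK mulmxBl !mxE; lra.
move=> x t; apply/eqP; rewrite eq_le le andbT.
by have := le (x + t *: v) (- t); rewrite scaleNr addrK; lra.
Qed.

(** As long as the columns taken from [D] do not span, they all vanish at some
    [v != 0], and any element of [D] that does not vanish at [v] increases the
    rank. *)
Lemma spanning_slopes (d : nat) (D : set 'cV[R]_d) :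
  (forall v : 'rV[R]_d, v != 0 -> exists2 xi, D xi & (v *m xi) 0 0 != 0) ->
  exists2 M : 'M[R]_d, M \in unitmx & forall i, D (col i M).
Proof.
move=> HD.
suff: forall j, (j <= d)%N ->
    exists2 M : 'M[R]_(d, j), \rank M = j & forall i, D (col i M).
  move=> /(_ d (leqnn d))[M rM DM]; exists M => //.
  by rewrite -row_free_unit /row_free rM.
elim=> [_|j IH jd].
  by exists 0; [rewrite mxrank0|case].
have [M rM DM] := IH (ltnW jd).
have kM : kermx M != 0 by rewrite -mxrank_eq0 mxrank_ker rM subn_eq0 -ltnNge.
have [v vM v0] : exists2 v : 'rV[R]_d, v *m M = 0 & v != 0.
  have /rowV0Pn[v /sub_kermxP vM v0] := kM.
  by exists v.
have [xi Dxi vxi] := HD v v0.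
rewrite -addn1; exists (row_mx M xi); last first.
  move=> i; rewrite -[i]splitK; case: (fintype.split i) => k /=.
    by rewrite colKl.
  rewrite colKr; suff -> : col k xi = xi by [].
  by apply/colP => l; rewrite !mxE ord1.
(* [v] lies in [kermx M] but is not killed by the enlarged matrix. *)
have lt_ker : (kermx (row_mx M xi) < kermx M)%MS.
  rewrite ltmxE; apply/andP; split.
    by have := mulmx_ker (row_mx M xi); rewrite mul_mx_row -[0]row_mx0
      => /eq_row_mx[/sub_kermxP].
  apply/negP => /(submx_trans (introT sub_kermxP vM)) /sub_kermxP.
  rewrite mul_mx_row -[0]row_mx0 => /eq_row_mx[_ vxi0].
  by rewrite vxi0 mxE eqxx in vxi.
have := rank_ltmx lt_ker; rewrite !mxrank_ker rM => lt_rk.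
apply/eqP; rewrite eqn_leq rank_leq_col /= leqNgt.
apply: contraL lt_rk; rewrite [X in (_ < X)%N]addn1 ltnS -leqNgt.
exact: leq_sub2l.
Qed.

(** * Quantitative convexity estimates *)

(** With [W] for [(1 - t) * A + t * B], the defect of [s |-> s + e / s] between
    [A] and [B] is exactly [e * t * (1 - t) * (A - B) ^+ 2 / (A * B * W)] by the
    weighted harmonic mean identity, and [A * B * W <= K ^+ 3]. Replacing [W] by
    a smaller [Z] can only increase the defect, because [s + e / s] increases
    for [s >= 1]. *)
Lemma reciprocal_defect (K e t A B Z : R) :
  0 <= t <= 1 -> 0 <= e <= 1 -> 1 <= A <= K -> 1 <= B <= K -> 1 <= Z <= K ->
  Z <= (1 - t) * A + t * B ->
  e * (t * (1 - t)) * (A - B) ^+ 2 / K ^+ 3 <=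
  (1 - t) * (A + e / A) + t * (B + e / B) - (Z + e / Z).
Proof.
move=> /andP[t0 t1] /andP[e0 e1] /andP[A1 AK] /andP[B1 BK] /andP[Z1 ZK] ZW.
have K0 : 0 < K by lra.
pose W := (1 - t) * A + t * B.
have W0 : 1 <= W by rewrite /W; nra.
have WK : W <= K by rewrite /W; nra.
have monoZ : Z + e / Z <= W + e / W.
  rewrite -subr_ge0.
  have -> : W + e / W - (Z + e / Z) = (W - Z) * ((W * Z - e) / (W * Z)).
    by field; rewrite !gt_eqF//; lra.
  apply: mulr_ge0; first by rewrite subr_ge0.
  by apply: divr_ge0; nra.
have defectW : (1 - t) * (A + e / A) + t * (B + e / B) - (W + e / W)
    = e * (t * (1 - t)) * (A - B) ^+ 2 * (A * B * W)^-1.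
  by rewrite /W; field; rewrite -/W !gt_eqF//; lra.
suff : e * (t * (1 - t)) * (A - B) ^+ 2 / K ^+ 3 <=
  e * (t * (1 - t)) * (A - B) ^+ 2 * (A * B * W)^-1 by rewrite -defectW; lra.
apply: ler_wpM2l.
  apply: mulr_ge0; last exact: sqr_ge0.
  by apply: mulr_ge0 => //; apply: mulr_ge0; lra.
rewrite lef_pV2 ?posrE ?exprn_gt0// ?mulr_gt0//; try lra.
rewrite exprS expr2 -mulrA; apply: ler_pM; [lra|apply: mulr_ge0; lra|lra|].
by apply: ler_pM; lra.
Qed.

(** If all the [p i] are small, then so are their differences: this is what
    makes a common shift of the [p i], such as the unknown increment of [f],
    harmless. *)
Lemma sum_sqr_spread (I : finType) (i0 : I) (p : I -> R) :
  \sum_i (p i0 - p i) ^+ 2 <= 2 * (#|I|%:R + 1) * \sum_i p i ^+ 2.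
Proof.
have le1 i : (p i0 - p i) ^+ 2 <= 2 * p i0 ^+ 2 + 2 * p i ^+ 2.
  by have := sqr_ge0 (p i0 + p i); rewrite !expr2; lra.
apply: le_trans (ler_sum _ (fun i _ => le1 i)) _.
rewrite big_split /= sumr_const -!mulr_sumr -[2 * p i0 ^+ 2 *+ _]mulr_natl.
have : p i0 ^+ 2 <= \sum_i p i ^+ 2.
  by rewrite (bigD1 i0)//= lerDl sumr_ge0// => i _; exact: sqr_ge0.
by have : 0 <= #|I|%:R :> R by []; nra.
Qed.

(** Bounds on the [H_i] are needed near each point, and convexity provides
    them from finitely many values of the function. *)
Lemma convex_bounded_above (d : nat) (f : 'rV[R]_d -> R) (p : 'rV[R]_d)
    (r : R) :
  @convex_function R 'rV[R]_d setT f -> 0 <= r ->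
  exists K, forall u : 'rV[R]_d, (forall i, `|u 0 i| <= r) -> f (p + u) <= K.
Proof.
move=> /convex_functionP fc r0.
suff: forall j, (j <= d)%N -> forall r, 0 <= r -> exists K, forall u : 'rV[R]_d,
    (forall i : 'I_d, (j <= i)%N -> u 0 i = 0) ->
    (forall i, `|u 0 i| <= r) -> f (p + u) <= K.
  move=> /(_ d (leqnn d) r r0)[K HK]; exists K => u; apply: HK => i.
  by rewrite leqNgt ltn_ord.
elim=> [_ {}r {}r0|j IH jd {}r {}r0].
  exists (f p) => u u0 _; have -> : u = 0 by apply/rowP => i; rewrite u0// mxE.
  by rewrite addr0.
have rr : 0 <= 2 * r by lra.
have [K HK] := IH (ltnW jd) _ rr.
pose jj := Ordinal jd; pose e : 'rV[R]_d := delta_mx 0 jj.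
pose L := Num.max (f (p - (2 * r) *: e)) (f (p + (2 * r) *: e)).
exists (K / 2 + L / 2) => u Hu ur.
(* [p + u] is the midpoint of [p + 2 *: u'], to which the induction hypothesis
   applies with radius [2 * r], and of a point of the line through [p] directed
   by [e]. *)
pose u' := u - u 0 jj *: e.
have u'le (i : 'I_d) : (2 *: u') 0 i = if i == jj then 0 else 2 * u 0 i.
  rewrite !mxE eqxx /=; have [->|ij] := eqVneq i jj.
    by rewrite mulr1 subrr mulr0.
  by rewrite mulr0 subr0.
have f1 : f (p + 2 *: u') <= K.
  apply: HK => i; rewrite u'le; have [_|ij] := eqVneq i jj => //.
  - move=> ji; rewrite Hu ?mulr0// ltn_neqAle ji andbT.
    by apply: contra ij => /eqP ij; apply/eqP/val_inj.
  - by rewrite normr0.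
  - by rewrite normrM ger0_norm// ler_pM2l.
have f2 : f (p + (2 * u 0 jj) *: e) <= L.
  have [r00|r00] := eqVneq r 0.
    have /eqP := ur jj; rewrite r00 normr_le0 => /eqP/eqP ->.
    by rewrite /L r00 mulr0 scale0r subr0 addr0 maxxx.
  have {r00}rp : 0 < r by rewrite lt_neqAle eq_sym r00.
  pose t := (r + u 0 jj) / (2 * r).
  have := ur jj; rewrite ler_norml => /andP[ul uu].
  have t01 : 0 <= t <= 1.
    by apply/andP; split; rewrite /t ?ler_pdivrMr ?ler_pdivlMr//; lra.
  have := fc (p - (2 * r) *: e) (p + (2 * r) *: e) t t01.
  have -> : (1 - t) *: (p - (2 * r) *: e) + t *: (p + (2 * r) *: e)
          = p + (2 * u 0 jj) *: e.
    rewrite !scalerDr addrACA -scalerDl subrK scale1r; congr (_ + _).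
    rewrite scalerN -scaleNr !scalerA -scalerDl; congr (_ *: _).
    by rewrite /t; field; rewrite gt_eqF.
  move=> /le_trans; apply.
  have : f (p - (2 * r) *: e) <= L by rewrite /L le_max lexx.
  have : f (p + (2 * r) *: e) <= L by rewrite /L le_max lexx orbT.
  by move: t01 => /andP[]; nra.
have h01 : 0 <= (2^-1 : R) <= 1 by apply/andP; split; lra.
have := fc (p + 2 *: u') (p + (2 * u 0 jj) *: e) 2^-1 h01.
have -> : (1 - 2^-1) *: (p + 2 *: u') + 2^-1 *: (p + (2 * u 0 jj) *: e) = p + u.
  have -> : 1 - 2^-1 = 2^-1 :> R by lra.
  rewrite !scalerDr !scalerA addrACA -scalerDl mulKf// mulVf//.
  have -> : 2^-1 + 2^-1 = 1 :> R by lra.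
  by rewrite !scale1r subrK.
lra.
Qed.

(** * Convex functions of one real variable *)

(** A derivative that does not exist takes the default value [0]. *)
Lemma derive1_neq0_derivable (f : R -> R) (a : R) :
  (f^`()%classic a) != 0 -> derivable f a 1.
Proof. by rewrite derive1E; exact: cvgNpoint. Qed.

(** The second derivative is only known to be positive as a value of
    [derive1n], which says nothing by itself about the existence of the first
    derivative [du]. But [du] is derivable at [a] with positive derivative, so
    it is nonzero at all other points near [a], and [u] is derivable wherever
    [du] is nonzero. The mean value theorem on both sides of [a] then compares
    the increments of [u] with [du a]. *)
Lemma derive2_gt0_midpoint (u : R -> R) (a : R) :
  (\forall s \near a, {for s, continuous u}) -> 0 < derive1n 2 u a ->
  exists2 r0, 0 < r0 & forall r, 0 < r < r0 -> 2 * u a < u (a + r) + u (a - r).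
Proof.
rewrite /derive1n /=; set du := u^`()%classic => cu ddu_gt0.
have du_derivable : derivable du a 1.
  by apply: derive1_neq0_derivable; rewrite gt_eqF.
have [e1 /= e10 He1] : exists2 e, 0 < e & forall h, `|h| < e -> h != 0 ->
    0 < h^-1 * (du (h + a) - du a).
  have qE : (fun h : R => h^-1 *: ((du \o shift a) (h *: (1 : R)) - du a))
      = fun h => h^-1 * (du (h + a) - du a).
    by apply/funext => h /=; rewrite [_%:A]mulr1.
  have cq : (fun h => h^-1 * (du (h + a) - du a)) @ (0 : R)^'
      --> du^`()%classic a.
    by move: du_derivable; rewrite derive1E /derivable /derive qE.
  have := @cvgr_gt _ _ _ (dnbhs_filter 0) _ _ cq _ ddu_gt0.
  rewrite near_withinE.
  move=> /nbhs_ballP[e /= e0 He]; exists e => // h he h0.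
  by apply: He => //=; rewrite -ball_normE /= sub0r normrN.
(* Near [a], [du] is nonzero except possibly at [a]: by continuity if
   [du a != 0], and because [du] increases through [a] if [du a = 0]. *)
have [e2 /= e20 He2] : exists2 e, 0 < e &
    forall s, `|a - s| < e -> s != a -> derivable u s 1.
  have [du0|du0] := eqVneq (du a) 0.
    exists e1; first exact: e10.
    move=> s sa s0; apply: derive1_neq0_derivable; apply/eqP => dus.
    have := He1 (s - a); rewrite distrC sa subrK -/du subr_eq0 s0.
    by rewrite [du s]dus du0 subrr mulr0 ltxx => /(_ isT isT).
  have du_cont : {for a, continuous du}.
    by apply: differentiable_continuous; exact/derivable1_diffP.
  have := @cvgr_neq0 _ _ _ _ (nbhs_filter a) _ _ du_cont du0.
  move=> /nbhs_ballP[e /= e0 He]; exists e; first exact: e0.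
  move=> s sa _.
  by apply: derive1_neq0_derivable; apply: He; rewrite -ball_normE.
have /nbhs_ballP[e3 /= e30 He3] := cu.
pose e := Num.min e1 (Num.min e2 e3).
have e_gt0 : 0 < e by rewrite /e !lt_min e10 e20 e30.
have [ee1 ee2 ee3] : [/\ e <= e1, e <= e2 & e <= e3].
  by split; rewrite /e !ge_min lexx ?orbT.
exists e => // r /andP[r0 re].
have mvt p q : p < q -> `|a - p| < e -> `|a - q| < e ->
    (forall s, p < s < q -> s != a) ->
    exists2 c, p < c < q & u q - u p = du c * (q - p).
  move=> pq ap aq pqa.
  have near_a s : p <= s <= q -> `|a - s| < e.
    move: ap aq; rewrite !ltr_norml => /andP[? ?] /andP[? ?] /andP[? ?].
    by apply/andP; split; lra.
  have [||c] := @MVT _ u du p q pq.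
  - move=> s; rewrite in_itv /= => psq.
    have us : derivable u s 1.
      apply: He2; last exact: pqa.
      apply: lt_le_trans ee2; apply: near_a; lra.
    by rewrite /du derive1E; exact: derivableP.
  - apply: continuous_in_subspaceT => s; rewrite inE /= in_itv /= => psq.
    apply: He3; rewrite -ball_normE /=.
    by apply: lt_le_trans ee3; exact: near_a.
  by rewrite in_itv /=; exists c.
have [||||c1 c1r E1] := mvt a (a + r).
- lra.
- by rewrite subrr normr0.
- by rewrite opprD addNKr normrN gtr0_norm.
- by move=> s /andP[? _]; rewrite gt_eqF.
have [||||c2 c2r E2] := mvt (a - r) a.
- lra.
- by rewrite subKr gtr0_norm.
- by rewrite subrr normr0.
- by move=> s /andP[_ ?]; rewrite lt_eqF.
have du1 : du a < du c1.
  have c1a : 0 < c1 - a by lra.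
  have := He1 (c1 - a); rewrite subrK gt_eqF// => /(_ _ isT).
  rewrite pmulr_rgt0 ?invr_gt0// subr_gt0; apply.
  by rewrite gtr0_norm//; lra.
have du2 : du c2 < du a.
  have c2a : c2 - a < 0 by lra.
  have := He1 (c2 - a); rewrite subrK lt_eqF// => /(_ _ isT).
  rewrite nmulr_rgt0 ?invr_lt0// subr_lt0; apply.
  by rewrite ltr0_norm//; lra.
nra.
Qed.

(** Near [a], convexity encloses the graph of [k] between the two lines that
    join its point above [a] to its points above [a - e / 2] and [a + e / 2]. *)
Lemma locally_convex_continuous (k : R -> R) (a e : R) : 0 < e ->
  (forall x y t, `|a - x| < e -> `|a - y| < e -> 0 <= t <= 1 ->
     k ((1 - t) * x + t * y) <= (1 - t) * k x + t * k y) ->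
  {for a, continuous k}.
Proof.
move=> e0 kc.
have three p q s : p < s -> p <= q <= s -> `|a - p| < e -> `|a - s| < e ->
    (s - p) * k q <= (s - q) * k p + (q - p) * k s.
  move=> ps /andP[pq qs] ap as_; pose t := (q - p) / (s - p).
  have sp0 : 0 < s - p by lra.
  have t01 : 0 <= t <= 1.
    by apply/andP; split; rewrite /t ?ler_pdivrMr ?ler_pdivlMr//; lra.
  have := kc p s t ap as_ t01.
  have -> : (1 - t) * p + t * s = q by rewrite /t; field; rewrite gt_eqF.
  rewrite -(ler_pM2l sp0).
  have -> // : (s - p) * ((1 - t) * k p + t * k s)
      = (s - q) * k p + (q - p) * k s.
  by rewrite /t; field; rewrite gt_eqF.
pose h := e / 2.
have h0 : 0 < h by rewrite /h; lra.
have he : h < e by rewrite /h; lra.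
pose M := `|k (a + h) - k a| + `|k (a - h) - k a|.
have nah : `|a - (a + h)| < e by rewrite opprD addNKr normrN gtr0_norm.
have nah' : `|a - (a - h)| < e by rewrite subKr gtr0_norm.
have M1 := ler_norm (k (a + h) - k a).
have M2 := ler_norm (k (a - h) - k a).
have lip r : `|r| <= h -> `|k (a + r) - k a| * h <= M * `|r|.
  rewrite ler_norml => /andP[rl ru].
  have nar : `|a - (a + r)| < e.
    by rewrite opprD addNKr normrN ltr_norml; apply/andP; split; lra.
  have na : `|a - a| < e by rewrite subrr normr0.
  have -> : `|k (a + r) - k a| * h = `|(k (a + r) - k a) * h|.
    by rewrite normrM (gtr0_norm h0).
  rewrite ler_norml.
  have [M1' M2'] : k (a + h) - k a <= M /\ k (a - h) - k a <= M.
    by split; rewrite /M; [have := normr_ge0 (k (a - h) - k a)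
                          |have := normr_ge0 (k (a + h) - k a)]; lra.
  have [r0|r0] := leP 0 r.
    have up := three a (a + r) (a + h) ltac:(lra) ltac:(lra) na nah.
    have lo := three (a - h) a (a + r) ltac:(lra) ltac:(lra) nah' nar.
    by rewrite (ger0_norm r0); apply/andP; split; nra.
  have up := three (a - h) (a + r) a ltac:(lra) ltac:(lra) nah' na.
  have lo := three (a + r) a (a + h) ltac:(lra) ltac:(lra) nar nah.
  by rewrite (ltr0_norm r0); apply/andP; split; nra.
have M0 : 0 <= M by rewrite /M addr_ge0.
apply/cvgrPdist_lt => eps eps0; apply/nbhs_ballP.
exists (Num.min h (eps * h / (M + 1))) => /=.
  by rewrite lt_min h0 divr_gt0 ?mulr_gt0//; lra.
move=> x ax; have : `|a - x| < Num.min h (eps * h / (M + 1)) := ax.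
rewrite lt_min distrC => /andP[xh].
rewrite ltr_pdivlMr; last lra.
move=> xM; have := lip (x - a) (ltW xh); rewrite [a + _]addrC subrK => lipx.
rewrite distrC -(ltr_pM2r h0); apply: le_lt_trans lipx _.
by have := normr_ge0 (x - a); lra.
Qed.

End convex_functions.

Section strong_convexity.

Context {R : realType} {d : nat}.

Implicit Types (x y v : 'rV[R]_d) (w : 'cV[R]_d) (f g : 'rV[R]_d -> R).

(** * Sums of squares of linear forms *)

Lemma linear_form_continuous w : continuous (fun x => (x *m w) 0 0).
Proof.
have -> : (fun x : 'rV[R]_d => (x *m w) 0 0) = fun x => \sum_j x 0 j * w j 0.
  by apply/funext => x; rewrite mxE.
apply: continuous_big; first exact: add_continuous.
move=> j _ x.
apply: (@continuousM _ _ (fun x : 'rV[R]_d => x 0 j) (fun=> w j 0)).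
  exact: coord_continuous.
exact: cst_continuous.
Qed.

(** The difference quotient is constant. *)
Lemma is_derive_linear_form w x v :
  is_derive x v (fun x => (x *m w) 0 0) ((v *m w) 0 0).
Proof.
have quotient : \forall h \near (0 : R)^',
    h^-1 *: (((fun x : 'rV[R]_d => (x *m w) 0 0) \o shift x) (h *: v)
      - (x *m w) 0 0) = (v *m w) 0 0.
  near=> h; have h0 : h != 0 by near: h; exact: nbhs_dnbhs_neq.
  rewrite /= mulmxDl -scalemxAl [X in _ *: (X - _)]mxE addrK mxE.
  by rewrite /GRing.scale /= mulKf.
split; first exact: (is_cvg_near_cst _ quotient).
exact: (lim_near_cst _ quotient).
Unshelve. all: by end_near. Qed.

Lemma class_C0 (V : set 'rV[R]_d) phi : continuous phi -> class_C 0 V phi.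
Proof. by move=> c; split=> // x _; exact: c. Qed.

(** Recognizes a function of class [C^k] from formulas for its partial
    derivatives. *)
Lemma class_CS (V : set 'rV[R]_d) k (phi : 'rV[R]_d -> R)
    (dphi : 'I_d -> 'rV[R]_d -> R) :
  continuous phi ->
  (forall i x, is_derive x (delta_mx 0 i) phi (dphi i x)) ->
  (forall i, class_C k V (dphi i)) ->
  class_C k.+1 V phi.
Proof.
move=> c dc H; split; first by move=> x _; exact: c.
move=> i; split; first by move=> x _; exact: ex_derive.
by have -> : (fun x => 'D_(delta_mx 0 i) phi x) = dphi i;
  [apply/funext => x; rewrite derive_val|].
Qed.

(** Every quadratic form subtracted below is of this kind; it is positive
    definite when [0 < c] and the [z i] separate vectors. *)
Definition sum_squares n (z : 'I_n -> 'cV[R]_d) (c : R) x :=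
  c * \sum_i (x *m z i) 0 0 ^+ 2.

Lemma class_C2_sum_squares (V : set 'rV[R]_d) n (z : 'I_n -> 'cV[R]_d) c :
  class_C 2 V (sum_squares z c).
Proof.
pose z' i : 'cV[R]_d := \sum_j (2 * c * (z j) i 0) *: z j.
have sqE : sum_squares z c = c *: \sum_i (fun x => (x *m z i) 0 0) ^+ 2.
  by apply/funext => x; rewrite /sum_squares /= fctE fct_sumE.
apply: (@class_CS _ _ _ (fun i x => (x *m z' i) 0 0)).
- move=> x; apply: (@continuousM _ _ (fun=> c)); first exact: cst_continuous.
  move: x; rewrite -[forall x, _]/(continuous _).
  apply: continuous_big; first exact: add_continuous.
  move=> j _ y; apply: (continuous_comp (g := fun r : R => r ^+ 2)).
    exact: linear_form_continuous.
  exact: exprn_continuous.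
- move=> i x; rewrite sqE.
  have dz k : is_derive x (delta_mx 0 i) (fun x : 'rV[R]_d => (x *m z k) 0 0)
      (((delta_mx 0 i : 'rV[R]_d) *m z k) 0 0).
    exact: is_derive_linear_form.
  apply: is_derive_eq.
  rewrite /z' mulmx_sumr summxE scaler_sumr; apply: eq_bigr => k _.
  rewrite -scalemxAr [RHS]mxE -rowE [row _ _ _ _]mxE /GRing.scale /= expr1.
  by ring.
move=> i.
apply: (@class_CS _ _ _ (fun k x => ((delta_mx 0 k : 'rV[R]_d) *m z' i) 0 0)).
- exact: linear_form_continuous.
- move=> k x; exact: is_derive_linear_form.
by move=> k; exact/class_C0/cst_continuous.
Qed.

Lemma derive2_sum_squares n (z : 'I_n -> 'cV[R]_d) c a v t :
  derive1n 2 (fun s : R => sum_squares z c (a + s *: v)) t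
  = 2 * sum_squares z c v.
Proof.
have poly_derive (p q r : R) :
    (fun s : R => p + q * s + r * s ^+ 2)^`()%classic = fun s => q + 2 * r * s.
  apply/funext => s; rewrite derive1E.
  have -> : (fun s : R => p + q * s + r * s ^+ 2)
      = cst p + q *: id + r *: id ^+ 2.
    by apply/funext.
  have id1 := is_derive_id s (1 : R).
  have dpoly := is_deriveD (is_deriveD (is_derive_cst p s 1) (is_deriveZ q id1))
    (is_deriveZ r (is_deriveX 2 id1)).
  rewrite (@derive_val _ _ _ _ _ _ _ dpoly) expr1 add0r.
  rewrite [q%:A]mulr1 [(2 * s)%:A]mulr1 -[r *: _]/(r * _).
  by ring.
pose B := c * \sum_i (2 * (a *m z i) 0 0 * (v *m z i) 0 0).
have -> : (fun s : R => sum_squares z c (a + s *: v))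
        = fun s => sum_squares z c a + B * s + sum_squares z c v * s ^+ 2.
  apply/funext => s; rewrite /sum_squares /B.
  rewrite -!mulrA -!mulrDr !mulr_suml -!big_split /=; congr (_ * _).
  apply: eq_bigr => i _; rewrite mulmxDl -scalemxAl.
  rewrite [X in X ^+ 2 = _]mxE [X in (_ + X) ^+ 2]mxE.
  by ring.
rewrite /derive1n /= poly_derive.
have -> : (fun s : R => B + 2 * sum_squares z c v * s)
        = fun s => B + (2 * sum_squares z c v) * s + 0 * s ^+ 2.
  by apply/funext => s; rewrite mul0r addr0.
by rewrite poly_derive mulr0 mul0r addr0.
Qed.

Lemma sum_squares_defect n (w : 'I_n -> 'cV[R]_d) (c : R) x y t :
  (1 - t) * sum_squares w c x + t * sum_squares w c y
    - sum_squares w c ((1 - t) *: x + t *: y)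
  = t * (1 - t) * sum_squares w c (x - y).
Proof.
rewrite /sum_squares ![_ * (c * _)]mulrCA -mulrDr -mulrBr; congr (_ * _).
rewrite !mulr_sumr -big_split -sumrB; apply: eq_bigr => i _ /=.
rewrite mulmxDl mulmxBl -!scalemxAl.
have mxD (a b : 'M[R]_1) : (a + b) 0 0 = a 0 0 + b 0 0 by rewrite mxE.
have mxZ a (b : 'M[R]_1) : (a *: b) 0 0 = a * b 0 0 by rewrite mxE.
have mxN (b : 'M[R]_1) : (- b) 0 0 = - b 0 0 by rewrite mxE.
by rewrite !mxD mxN !mxZ; ring.
Qed.

Lemma strongly_convex_C2_sum_squares (V : set 'rV[R]_d) n
    (w : 'I_n -> 'cV[R]_d) (c : R) :
  0 < c -> (forall v, v != 0 -> exists i, (v *m w i) 0 0 != 0) ->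
  strongly_convex_C2 V (sum_squares w c).
Proof.
move=> c0 wspan; split; first exact: class_C2_sum_squares.
move=> a v t v0 _; rewrite derive2_sum_squares !mulr_gt0//.
have [i vi] := wspan v v0; rewrite (bigD1 i)//= ltr_wpDr//.
  by apply: sumr_ge0 => j _; exact: sqr_ge0.
by rewrite lt_neqAle eq_sym sqrf_eq0 vi sqr_ge0.
Qed.

(** * Smoothing with reciprocals *)

Lemma smoothing_uniform (I : finType) (e : R) (H : I -> R) :
  0 <= e -> (forall i, 1 <= H i) ->
  0 <= e / #|I|%:R * \sum_i (H i)^-1 <= e.
Proof.
move=> e0 H1; have Hi0 i : 0 <= (H i)^-1 by rewrite invr_ge0; have := H1 i; lra.
apply/andP; split.
  by apply: mulr_ge0; [rewrite divr_ge0|rewrite sumr_ge0].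
have [I0|I0] := posnP #|I|.
  by rewrite I0 invr0 mulr0 mul0r.
rewrite mulrAC ler_pdivrMr ?ltr0n//; apply: ler_wpM2l => //.
rewrite -sumr_const ler_sum// => i _.
by rewrite invf_le1 ?H1//; have := H1 i; lra.
Qed.

(** The functions [H i] are bounded by some [K] near any given point [p], and
    there the defect of the smoothing of [f] dominates that of a small multiple
    of the sum of the squares of the linear forms [z i - z ord0]. *)
Lemma smoothing_strongly_convex (f : 'rV[R]_d -> R) n (z : 'I_n.+1 -> 'cV[R]_d)
    (b : 'I_n.+1 -> R) (e : R) :
  @convex_function R 'rV[R]_d setT f ->
  (forall i x, (x *m z i) 0 0 + b i <= f x) ->
  (forall v, v != 0 -> exists i, (v *m (z i - z ord0)) 0 0 != 0) ->
  0 < e <= 1 ->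
  strongly_convex
    (fun x => f x + e / n.+1%:R * \sum_i (f x - ((x *m z i) 0 0 + b i) + 1)^-1).
Proof.
move=> /[dup] fconv /convex_functionP fc zf zspan /andP[e0 e1].
pose H i x := f x - ((x *m z i) 0 0 + b i) + 1; pose N : R := n.+1%:R.
rewrite -[X in strongly_convex X]/(fun x => f x + e / N * \sum_i (H i x)^-1).
move=> p.
have H1 i x : 1 <= H i x by rewrite /H; have := zf i x; lra.
have pairE i x y t : (((1 - t) *: x + t *: y) *m z i) 0 0
    = (1 - t) * (x *m z i) 0 0 + t * (y *m z i) 0 0.
  by rewrite mulmxDl -!scalemxAl [LHS]mxE; congr (_ + _); rewrite [LHS]mxE.
have Hc i : @convex_function R 'rV[R]_d setT (H i).
  apply/convex_functionP => x y t t01; rewrite /H pairE.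
  by have := fc x y t t01; lra.
have /choice[Kf HK] i := convex_bounded_above p (Hc i) ler01.
pose K := 1 + \sum_i `|Kf i|.
have K1 : 1 <= K by rewrite /K lerDl sumr_ge0.
pose V := ball p (1 : R).
have HKV i x : V x -> H i x <= K.
  move=> Vx; have -> : x = p + (x - p) by rewrite addrC subrK.
  apply: le_trans (HK i _ _) _.
    move=> j; have := Vx.2 0 j; rewrite /ball /= !mxE distrC => /ltW; exact.
  rewrite /K (bigD1 i)//=; have := ler_norm (Kf i).
  have : 0 <= \sum_(j < n.+1 | j != i) `|Kf j| by apply: sumr_ge0.
  lra.
have N0 : 0 < N by rewrite ltr0n.
(* [K ^+ 3] comes from [reciprocal_defect], [2 * (N + 1)] from
   [sum_sqr_spread], and the other [N] from the mean over the [H i]. *)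
pose k : R := e / (2 * N * (N + 1) * K ^+ 3).
have K30 : 0 < K ^+ 3 by apply: exprn_gt0; lra.
have k0 : 0 < k by apply: divr_gt0 => //; rewrite !mulr_gt0//; lra.
pose w i := z i - z ord0.
exists V; split; [exact: ball_open|exact: ballxx|].
exists (sum_squares w k).
  exact: strongly_convex_C2_sum_squares.
move=> x y Vxy t t01.
have Vx : V x.
  by have := Vxy 0; rewrite lexx ler01 subr0 scale1r scale0r addr0; exact.
have Vy : V y.
  by have := Vxy 1; rewrite lexx ler01 subrr scale1r scale0r add0r; exact.
set u := (1 - t) *: x + t *: y.
have Vu : V u := Vxy t t01.
(* [f] and [H i] have the same defect, since they differ by an affine
   function. *)
have defect i : e * (t * (1 - t)) * (H i x - H i y) ^+ 2 / K ^+ 3 <=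
    ((1 - t) * f x + t * f y - f u)
    + e * ((1 - t) / H i x + t / H i y - (H i u)^-1).
  have e01 : 0 <= e <= 1 by rewrite e1 ltW.
  have Hle j v : V v -> 1 <= H j v <= K by move=> /HKV ->; rewrite H1.
  have Huc : H i u <= (1 - t) * H i x + t * H i y.
    by have /convex_functionP := Hc i; exact.
  have := reciprocal_defect t01 e01 (Hle i x Vx) (Hle i y Vy) (Hle i u Vu) Huc.
  have : (1 - t) * H i x + t * H i y - H i u = (1 - t) * f x + t * f y - f u.
    by rewrite /H /u pairE; ring.
  lra.
have {}defect := ler_sum (index_enum 'I_n.+1) (fun i (_ : predT i) => defect i).
rewrite -mulr_suml -mulr_sumr big_split /= sumr_const card_ord -mulr_sumr
  in defect.
have defphi := sum_squares_defect w k x y t; rewrite -/u in defphi.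
have spread : sum_squares w k (x - y) <=
    k * (2 * (N + 1) * \sum_i (H i x - H i y) ^+ 2).
  rewrite /sum_squares ler_pM2l//.
  have := sum_sqr_spread ord0 (fun i => H i x - H i y).
  rewrite card_ord; apply: le_trans; apply: ler_sum => i _.
  suff -> : ((x - y) *m w i) 0 0 = H ord0 x - H ord0 y - (H i x - H i y) by [].
  have mxB (A B : 'M[R]_1) : (A - B) 0 0 = A 0 0 - B 0 0 by rewrite !mxE.
  by rewrite /w /H mulmxBl !mulmxBr !mxB; ring.
set S := \sum_i (H i x - H i y) ^+ 2 in spread defect *.
have kS : k * (2 * (N + 1) * S) = e * S / K ^+ 3 / N.
  by rewrite /k; field; rewrite !gt_eqF//; lra.
have := t01 => /andP[t0 t1].
have t1t : 0 <= t * (1 - t) by apply: mulr_ge0; lra.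
rewrite kS in spread.
have spread' : t * (1 - t) * sum_squares w k (x - y) * N <=
    e * (t * (1 - t)) * S / K ^+ 3.
  have -> : e * (t * (1 - t)) * S / K ^+ 3
      = t * (1 - t) * (e * S / K ^+ 3 / N) * N.
    by field; rewrite !gt_eqF//; lra.
  by rewrite ler_pM2r// ler_wpM2l.
have sumE : \sum_i ((1 - t) / H i x + t / H i y - (H i u)^-1)
  = (1 - t) * \sum_i (H i x)^-1 + t * \sum_i (H i y)^-1 - \sum_i (H i u)^-1.
  by rewrite sumrB big_split -!mulr_sumr.
rewrite -mulr_natl -/N sumE in defect.
have {}defect := le_trans spread' defect.
cbv beta; rewrite -/u.
set Sx := \sum_i (H i x)^-1 in defect *.
set Sy := \sum_i (H i y)^-1 in defect *.
set Su := \sum_i (H i u)^-1 in defect *.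
have : t * (1 - t) * sum_squares w k (x - y) <=
    (1 - t) * f x + t * f y - f u + e / N * ((1 - t) * Sx + t * Sy - Su).
  rewrite -(ler_pM2r N0); apply: le_trans defect _.
  by rewrite le_eqVlt; apply/orP; left; apply/eqP; field; rewrite gt_eqF.
move: defphi; move: (sum_squares w k x) (sum_squares w k y) (sum_squares w k u).
move: (sum_squares w k (x - y)) (f x) (f y) (f u) (e / N) (Sx) (Sy) (Su).
by clear=> *; lra.
Qed.

(** * Strong convexity implies strict convexity *)

(** Along a line, a strongly convex function is locally a convex function plus
    one with positive second derivative: the first gives a weak inequality at
    midpoints, the second a strict one. *)
Lemma strongly_convex_midpoint (g : 'rV[R]_d -> R) x v : v != 0 ->
  strongly_convex g ->
  {for 0, continuous (fun s : R => g (x + s *: v))} /\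
  exists2 r0, 0 < r0 & forall r, 0 < r < r0 ->
    2 * g x < g (x + r *: v) + g (x - r *: v).
Proof.
move=> v0 /(_ x)[V [oV Vx [phi [phiC phi2] gc]]].
pose line (s : R) : 'rV[R]_d := x + s *: v.
have line_cont : continuous line.
  move=> s; apply: cvgD; first exact: cvg_cst.
  by apply: cvgZr_tmp; exact: cvg_id.
have line0 : line 0 = x by rewrite /line scale0r addr0.
have Vline : \forall s \near (0 : R), V (line s).
  by apply: (line_cont 0); rewrite line0; exact: open_nbhs_nbhs.
have phi_cont s : V (line s) -> {for s, continuous (phi \o line)}.
  move=> Vs; apply: continuous_comp; first exact: line_cont.
  by case: phiC => + _; apply.
have /nbhs_ballP[e /= e0 He] := Vline.
have VeP s : `|0 - s| < e -> V (line s).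
  by move=> se; apply: He; rewrite -ball_normE.
have kc s1 s2 t : `|0 - s1| < e -> `|0 - s2| < e -> 0 <= t <= 1 ->
    g (line ((1 - t) * s1 + t * s2)) - phi (line ((1 - t) * s1 + t * s2)) <=
    (1 - t) * (g (line s1) - phi (line s1)) + t * (g (line s2) - phi (line s2)).
  move=> s1e s2e t01.
  have lineE t' : (1 - t') *: line s1 + t' *: line s2
      = line ((1 - t') * s1 + t' * s2).
    rewrite /line !scalerDr addrACA -scalerDl subrK scale1r !scalerA.
    by rewrite -scalerDl.
  rewrite -lineE; apply: gc => // t' t'01; rewrite lineE; apply: VeP.
  move: s1e s2e t'01; rewrite !sub0r !normrN => s1e s2e /andP[t'0 t'1].
  pose m := Num.max `|s1| `|s2|.
  have me : m < e by rewrite gt_max s1e s2e.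
  have s1m : `|s1| <= m by rewrite le_max lexx.
  have s2m : `|s2| <= m by rewrite le_max lexx orbT.
  apply: le_lt_trans (ler_normD _ _) _.
  rewrite !normrM (ger0_norm t'0) ger0_norm; last lra.
  by apply: le_lt_trans me; nra.
split.
  have -> : (fun s => g (x + s *: v)) =
      (fun s => g (line s) - phi (line s)) \+ (phi \o line).
    by apply/funext => s /=; rewrite subrK.
  apply: continuousD; last by apply: phi_cont; rewrite line0.
  exact: (locally_convex_continuous e0).
have [||r0 r00 Hr0] := @derive2_gt0_midpoint _ (phi \o line) 0.
- by near=> s; apply: phi_cont; near: s.
- by apply: phi2 => //; rewrite -/(line 0) line0.
exists (Num.min r0 e); first by rewrite lt_min r00.
move=> r /andP[r_gt0]; rewrite lt_min => /andP[rr0 re].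
have := Hr0 r; rewrite r_gt0 rr0 /= add0r sub0r line0 => /(_ isT) phir.
have := kc (- r) r 2^-1; rewrite !sub0r opprK normrN gtr0_norm// re.
have -> : (1 - 2^-1) * - r + 2^-1 * r = 0 by lra.
rewrite line0.
have h01 : 0 <= (2^-1 : R) <= 1 by apply/andP; split; lra.
move=> /(_ isT isT h01).
by rewrite -scaleNr -/(line r) -/(line (- r)); lra.
Unshelve. all: by end_near. Qed.

(** From local to global: if strict convexity fails on a segment, the
    difference between [g] and the chord has a maximum at an interior point of
    the segment, and this contradicts the strict midpoint inequality there.
    Continuity along lines serves to reach the maximum. *)
Lemma strongly_convex_strictly (g : 'rV[R]_d -> R) :
  strongly_convex g -> strictly_convex g.
Proof.
move=> gs x y t xy /andP[t0 t1]; rewrite ltNge; apply/negP => bad.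
pose v := y - x.
have v0 : v != 0 by rewrite subr_eq0 eq_sym.
pose u s := g (x + s *: v).
pose w s := u s - ((1 - s) * u 0 + s * u 1).
have midpoint s := strongly_convex_midpoint (x + s *: v) v0 gs.
have w_cont : continuous w.
  move=> s; apply: (@continuousB _ _ _ u).
    have [sc _] := midpoint s.
    have -> : u = (fun h => g (x + s *: v + h *: v)) \o (fun r => r - s).
      by apply/funext => r /=; rewrite /u -addrA -scalerDl [s + _]addrC subrK.
    apply: continuous_comp; last by rewrite /= subrr.
    apply: (@continuousB _ _ _ id (cst s)); first exact: cvg_id.
    exact: cst_continuous.
  apply: continuousD; apply: continuousM; try exact: cst_continuous.
    by apply: continuousB; [exact: cst_continuous|exact: cvg_id].
  exact: cvg_id.
have w_t : 0 <= w t.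
  rewrite /w /u scale0r addr0 scale1r /v [x + (y - x)]addrC subrK subr_ge0.
  have -> : x + t *: (y - x) = (1 - t) *: x + t *: y.
    by rewrite scalerBr scalerBl scale1r addrCA addrC.
  exact: bad.
have [w0 w1] : w 0 = 0 /\ w 1 = 0 by rewrite /w; split; ring.
(* If the maximum of [w] is reached at an end of the segment, then it is [0] and
   is also reached at [t]. *)
have [c c01 cmax] : exists2 c, 0 < c < 1 & forall s, 0 <= s <= 1 -> w s <= w c.
  have [c] := EVT_max ler01 (continuous_subspaceT w_cont).
  rewrite in_itv /= => /andP[c0 c1] cmax.
  have {}cmax s : 0 <= s <= 1 -> w s <= w c.
    by move=> s01; apply: cmax; rewrite in_itv.
  have [c01|] := boolP (0 < c < 1); first by exists c.
  rewrite negb_and -!leNgt => c01; exists t; first by rewrite t0 t1.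
  move=> s s01; apply: le_trans w_t; apply: le_trans (cmax s s01) _.
  have [c_le0|c_ge1] := orP c01.
    have -> : c = 0 by lra.
    by rewrite w0.
  have -> : c = 1 by lra.
  by rewrite w1.
have [_ [r0 r00 Hr0]] := midpoint c.
pose r := Num.min (r0 / 2) (Num.min c (1 - c)).
have [r_gt0 rr0 rc rc1] : [/\ 0 < r, r < r0, r <= c & r <= 1 - c].
  split; rewrite /r ?lt_min ?gt_min ?ge_min ?lexx ?orbT//.
    by apply/and3P; split; lra.
  by apply/orP; left; lra.
have := Hr0 r; rewrite r_gt0 rr0 -!addrA -scalerDl -scalerBl => /(_ isT).
rewrite -/(u c) -/(u (c + r)) -/(u (c - r)) => mid.
have := cmax (c + r); have := cmax (c - r); rewrite /w.
have -> : 0 <= c - r <= 1 by apply/andP; split; lra.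
have -> : 0 <= c + r <= 1 by apply/andP; split; lra.
move=> /(_ isT) + /(_ isT); lra.
Qed.

(** * Affine directions *)

Definition affine_in_direction f v :=
  exists a, forall x t, f (x + t *: v) = f x + t * a.

(** Otherwise [s |-> g (s *: v) - s * a], being convex, would grow at least
    linearly for [s >= 1], but it is within [1] of the constant [f 0]. *)
Lemma strictly_convex_near_affine_line f g v a :
  (forall x t, f (x + t *: v) = f x + t * a) -> v != 0 ->
  strictly_convex g -> (forall x, `|f x - g x| <= 1) -> g v - a <= g 0.
Proof.
move=> fv v0 gc fg; rewrite leNgt; apply/negP => gv.
pose eta := g v - a - g 0.
have eta0 : 0 < eta by rewrite /eta; lra.
(* Going from [0] to [T *: v], the bounded function gains at least [T * eta],
   which exceeds the allowed oscillation [2]. *)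
pose T := 2 + 2 / eta.
have T0 : 0 < T by rewrite /T addr_gt0// divr_gt0.
have Teta : T * eta = 2 * eta + 2 by rewrite /T; field; rewrite gt_eqF.
have t01 : 0 < T^-1 < 1.
  rewrite invr_gt0 T0 invf_lt1//= /T; have : 0 < 2 / eta by rewrite divr_gt0.
  lra.
have neq : 0 != T *: v by rewrite eq_sym scaler_eq0 negb_or gt_eqF.
have := gc 0 (T *: v) T^-1 neq t01.
rewrite scaler0 add0r scalerA mulVf ?gt_eqF// scale1r -(ltr_pM2l T0).
have -> : T * ((1 - T^-1) * g 0 + T^-1 * g (T *: v))
    = (T - 1) * g 0 + g (T *: v).
  by field; rewrite gt_eqF.
have := fg (T *: v); have := fg 0; have := fv 0 T; rewrite add0r.
rewrite !ler_norml => -> /andP[? ?] /andP[? ?].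
rewrite /eta in Teta *; lra.
Qed.

(** The previous bound, applied to [v] and to [- v], contradicts strict
    convexity at the midpoint [0]. *)
Lemma affine_in_direction_not_approximable f v : v != 0 ->
  affine_in_direction f v -> ~ uniformly_approximable (@strictly_convex R d) f.
Proof.
move=> v0 [a fv] /(_ 1 ltr01)[g gc fg].
have fNv x t : f (x + t *: - v) = f x + t * - a.
  by rewrite scalerN -scaleNr fv mulrN mulNr.
have Nv0 : - v != 0 by rewrite oppr_eq0.
have g1 := strictly_convex_near_affine_line fv v0 gc fg.
have g2 := strictly_convex_near_affine_line fNv Nv0 gc fg.
have vNv : - v != v.
  rewrite -subr_eq0 -opprD oppr_eq0 -mulr2n -scaler_nat scaler_eq0.
  by rewrite negb_or pnatr_eq0.
have h01 : 0 < (2^-1 : R) < 1 by apply/andP; split; lra.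
have := gc (- v) v 2^-1 vNv h01.
have -> : 1 - 2^-1 = 2^-1 :> R by lra.
by rewrite -scalerDr addNr scaler0; lra.
Qed.

Definition factors_through_projection f :=
  exists (k : nat) (P : {linear 'rV[R]_d -> 'rV[R]_k}) (c : 'rV[R]_k -> R)
          (l : {scalar 'rV[R]_d}),
     [/\ (k < d)%N,
         forall y : 'rV[R]_k, exists x : 'rV[R]_d, P x = y,
         @convex_function R 'rV[R]_k setT c &
         forall x : 'rV[R]_d, f x = c (P x) + l x].

Lemma factors_affine_in_direction f :
  factors_through_projection f -> exists2 v, v != 0 & affine_in_direction f v.
Proof.
move=> [k [P [c [l [kd _ _ fE]]]]].
have kerP : kermx (lin1_mx P) != 0.
  rewrite -mxrank_eq0 mxrank_ker subn_eq0 -ltnNge.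
  exact: leq_ltn_trans (rank_leq_col _) kd.
have /rowV0Pn[v /sub_kermxP vP v0] := kerP.
exists v => //; exists (l v) => x t.
rewrite !fE !linearD !linearZ /= -[P v]mul_rV_lin1 vP scaler0 addr0.
by rewrite addrA.
Qed.

End strong_convexity.

(** The coordinate [j] with [v 0 j != 0] serves as a pivot. The projector along
    [v] onto the hyperplane of vectors with zero [j]-th coordinate is
    [1%:M - E *m v]; composing it with the coordinates other than [j] gives the
    matrix [A] of the projection, and inserting a zero coordinate gives the
    matrix [S] of a linear section. *)
Lemma affine_in_direction_factors (R : realType) (d : nat) (f : 'rV[R]_d -> R)
    (v : 'rV[R]_d) :
  @convex_function R 'rV[R]_d setT f -> v != 0 -> affine_in_direction f v ->
  factors_through_projection f.
Proof.
case: d f v => [|d] f v /convex_functionP fc v0 [a fv].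
  by case/negP: v0; apply/eqP/rowP => -[].
have [j vj] : exists j, v 0 j != 0.
  apply/existsP; apply: contraNT v0; rewrite negb_exists => /forallP v0.
  by apply/eqP/rowP => j; rewrite mxE; apply/eqP; have := v0 j; rewrite negbK.
pose E : 'cV[R]_d.+1 := (v 0 j)^-1 *: delta_mx j 0.
have xE x : (x *m E) 0 0 = x 0 j / v 0 j.
  by rewrite /E -scalemxAr -colE !mxE mulrC.
pose A : 'M[R]_(d.+1, d) := col' j (1%:M - E *m v).
pose S : 'M[R]_(d, d.+1) := row' j 1%:M.
have Qj i : (1%:M - E *m v) i j = 0.
  rewrite /E -scalemxAl !mxE big_ord1 !mxE andbT.
  by rewrite [_%:R * v 0 j]mulrC mulKf// subrr.
have AS : A *m S = 1%:M - E *m v.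
  apply/matrixP => i k; rewrite -[in RHS](mulmx1 (1%:M - E *m v)) !mxE.
  rewrite [RHS](bigD1_ord j)//= Qj mul0r add0r.
  by apply: eq_bigr => m _; rewrite !mxE.
have SE : S *m E = 0.
  rewrite /S row'Esub mul_rowsub_mx mul1mx; apply/colP => i.
  by rewrite !mxE eq_sym (negbTE (neq_lift _ _)) mulr0.
have SA : S *m A = 1%:M.
  rewrite /A col'Esub mulmx_colsub mulmxBr mulmx1 mulmxA SE mul0mx subr0.
  by apply/matrixP => i k; rewrite !mxE (inj_eq lift_inj).
have l_lin : linear_for *%R (fun x : 'rV[R]_d.+1 => (x *m (a *: E)) 0 0).
  move=> r x y; rewrite mulmxDl -scalemxAl.
  by rewrite [LHS]mxE; congr (_ + _); rewrite mxE.
pose l : {scalar 'rV[R]_d.+1} := HB.pack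
  (fun x : 'rV[R]_d.+1 => (x *m (a *: E)) 0 0)
  (GRing.isLinear.Build _ _ _ _ _ l_lin).
exists d, (mulmxr A), (fun y => f (y *m S)), l; split.
- exact: ltnSn.
- by move=> y; exists (y *m S); rewrite /= -mulmxA SA mulmx1.
- apply/convex_functionP => x y t t01.
  by rewrite mulmxDl -!scalemxAl; exact: fc.
move=> x; rewrite /= -mulmxA AS -scalemxAr [X in _ + X]mxE xE mulrC -fv.
congr f; rewrite mulmxBr mulmx1 mulmxA [x *m E]mx11_scalar mul_scalar_mx xE.
by rewrite subrK.
Qed.

(** The family given to the smoothing consists of the subgradient [xi0] at the
    origin and of its translates by the columns of an invertible matrix, so that
    the differences of slopes are these columns. *)
Lemma not_affine_approximable (R : realType) (d : nat) (f : 'rV[R]_d -> R) :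
  @convex_function R 'rV[R]_d setT f ->
  (forall v, v != 0 -> ~ affine_in_direction f v) ->
  uniformly_approximable (@strongly_convex R d) f.
Proof.
move=> fc naff.
have [xi0 xi0_sub] := subgradient_exists 0 fc.
pose D := [set eta | minorant_slope f (xi0 + eta)].
have Dspan (v : 'rV[R]_d) : v != 0 -> exists2 eta, D eta & (v *m eta) 0 0 != 0.
  move=> v0; apply: contrapT => noD; apply: (naff v v0).
  exists ((v *m xi0) 0 0); apply: affine_along => // xi xi_min.
  apply: contrapT => neq; apply: noD.
  exists (xi - xi0); first by rewrite /D /= addrC subrK.
  by rewrite mulmxBr mxE [X in _ + X]mxE subr_eq0; exact/eqP.
have [M Mu DM] := spanning_slopes Dspan.
pose z (i : 'I_d.+1) := if unlift ord0 i is Some k then xi0 + col k M else xi0.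
have zmin i : minorant_slope f (z i).
  rewrite /z; case: unliftP => [k _|_]; first exact: DM.
  by exists (f 0) => x; have := xi0_sub x; rewrite add0r addrC.
have [b zb] := choice zmin.
move=> e e0; pose e' := Num.min e 1.
have e'01 : 0 < e' <= 1 by rewrite lt_min e0 ltr01 ge_min lexx orbT.
exists (fun x =>
  f x + e' / d.+1%:R * \sum_i (f x - ((x *m z i) 0 0 + b i) + 1)^-1).
  apply: smoothing_strongly_convex => // v v0.
  apply: contrapT => nospan; case/negP: v0; apply/eqP.
  rewrite -[v](mulmxK Mu); suff -> : v *m M = 0 by rewrite mul0mx.
  apply/rowP => k; rewrite [RHS]mxE; apply: contrapT => vk; apply: nospan.
  exists (lift ord0 k); rewrite /z liftK unlift_none addrC addKr.
  by rewrite colE mulmxA -colE mxE; exact/eqP.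
move=> x; have H1 i : 1 <= f x - ((x *m z i) 0 0 + b i) + 1.
  by have := zb i x; lra.
have /andP[e'0 _] := e'01.
have := smoothing_uniform (ltW e'0) H1; rewrite card_ord => /andP[s0 s1].
rewrite opprD addNKr normrN ger0_norm//; apply: le_trans s1 _.
by rewrite ge_min lexx.
Qed.

Theorem proposition1 (R : realType) (d : nat) (f : 'rV[R]_d -> R)
    (f_convex : @convex_function R 'rV[R]_d setT f) :
  (~ uniformly_approximable (@strictly_convex R d) f <->
   ~ uniformly_approximable (@strongly_convex R d) f) /\
  (~ uniformly_approximable (@strongly_convex R d) f <->
   exists (k : nat) (P : {linear 'rV[R]_d -> 'rV[R]_k}) (c : 'rV[R]_k -> R)
          (l : {scalar 'rV[R]_d}),
     [/\ (k < d)%N,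
         forall y : 'rV[R]_k, exists x : 'rV[R]_d, P x = y,
         @convex_function R 'rV[R]_k setT c &
         forall x : 'rV[R]_d, f x = c (P x) + l x]).
Proof.
have strong_strict : uniformly_approximable (@strongly_convex R d) f ->
    uniformly_approximable (@strictly_convex R d) f.
  move=> approx e e0; have [g gs fg] := approx e e0.
  by exists g => //; exact: strongly_convex_strictly.
have not_strong_factors : ~ uniformly_approximable (@strongly_convex R d) f ->
    factors_through_projection f.
  move=> napprox; apply: contrapT => nfactors; apply: napprox.
  apply: not_affine_approximable => // v v0 faff; apply: nfactors.
  exact: affine_in_direction_factors faff.
have factors_not_strict : factors_through_projection f ->
    ~ uniformly_approximable (@strictly_convex R d) f.
  move=> /factors_affine_in_direction[v v0 faff].
  exact: affine_in_direction_not_approximable v0 faff.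
split; split.
- by move=> nstrict /strong_strict.
- by move=> /not_strong_factors/factors_not_strict.
- exact: not_strong_factors.
- by move=> /factors_not_strict nstrict /strong_strict.
Qed.
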